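(* Let $X$ be a Banach space and let $f:[0,1]\to X$ be any mapping. Then $f$ is strongly Birkhoff integrable if and only if it is strongly measurable and Birkhoff integrable.
   Context: $\lambda$ is Lebesgue measure on $[0,1]$ and $\mathcal{L}$ the family of Lebesgue measurable subsets of $[0,1]$. A countable partition of $[0,1]$ in $\mathcal{L}$ is a countable family of pairwise disjoint sets of $\mathcal{L}$ with union $[0,1]$; a countable partition in $\mathcal{L}$ is a refinement of (finer than) another if each of its members is contained in a member of the other. $f:[0,1]\to X$ is strongly measurable if it is the almost everywhere norm limit of a sequence of simple measurable functions. $f$ is Birkhoff integrable if there is $x\in X$ such that for every $\varepsilon>0$ there is a countable partition $\Pi_0$ of $[0,1]$ in $\mathcal{L}$ such that for every countable partition $(A_n)_n$ of $[0,1]$ in $\mathcal{L}$ finer than $\Pi_0$ and any choice of points $t_n\in A_n$, the series $\sum_n\lambda(A_n)f(t_n)$ is unconditionally convergent in norm and $\|x-\sum_n f(t_n)\lambda(A_n)\|<\varepsilon$. $f$ is strongly Birkhoff integrable if there is a $\lambda$-continuous $\sigma$-additive measure $\phi:\mathcal{L}\to X$ (i.e. $\phi(A)=0$ whenever $\lambda(A)=0$) such that for every $\varepsilon>0$ there is a countable partition $P$ of $[0,1]$ into measurable sets such that, whenever $\{A_n\}_n$ is a countable measurable partition of $[0,1]$ refining $P$, one has $\sum_n\|f(t_n)\lambda(A_n)-\phi(A_n)\|\le\varepsilon$ for every choice of $t_n\in A_n$, $n\in\mathbb{N}$. *)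

(* Defs.v *)
From HB Require Import structures.
From mathcomp Require Import all_boot all_order all_algebra.
From mathcomp Require Import all_classical all_reals all_analysis.

Set Implicit Arguments.
Unset Strict Implicit.
Unset Printing Implicit Defensive.

Import Order.TTheory GRing.Theory Num.Theory.
Import numFieldNormedType.Exports.

Local Open Scope classical_set_scope.
Local Open Scope ring_scope.

(* The library's [lebesgue_measure] only lives on the Borel sets; the Lebesgue
   measurable sets are the measurable sets of its completion. *)
Notation lambda := completed_lebesgue_measure.

Definition Lebesgue_sets (R : realType) : set (set R) :=
  [set A | ((wlength idfun)^*%mu).-cara.-measurable A /\ A `<=` `[0, 1]%classic].

(* Finite partitions are covered by padding with empty sets. *)
Definition countable_partition (R : realType) (A : nat -> set R) : Prop :=
  [/\ forall n, Lebesgue_sets (A n),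
      trivIset setT A &
      \bigcup_n A n = `[0, 1]%classic].

Definition finer (R : realType) (A B : nat -> set R) : Prop :=
  forall n, exists m, A n `<=` B m.

(* No point is chosen in the empty members of the family; their terms in the
   sums below vanish whatever the value of [t]. *)
Definition choice_of_points (R : realType) (A : nat -> set R)
    (t : nat -> R) : Prop :=
  forall n, A n !=set0 -> A n (t n).

Definition unconditionally_convergent (R : realType)
    (X : completeNormedModType R) (u : nat -> X) : Prop :=
  forall s : nat -> nat, bijective s -> cvgn (series (u \o s)).

(* A map [0, 1] -> X is represented by a total function R -> X; only its values
   on [0, 1] are constrained or used, here and below. *)
Definition simple_measurable (R : realType) (X : completeNormedModType R)
    (s : R -> X) : Prop :=
  finite_set (s @` `[0, 1]%classic) /\
  forall x : X, Lebesgue_sets (`[0, 1]%classic `&` s @^-1` [set x]).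

Definition strongly_measurable (R : realType) (X : completeNormedModType R)
    (f : R -> X) : Prop :=
  exists s : nat -> R -> X,
    (forall k, simple_measurable (s k)) /\
    {ae @lambda R, forall x : R, `[0, 1]%classic x -> s ^~ x @ \oo --> f x}.

Definition Birkhoff_integrable (R : realType) (X : completeNormedModType R)
    (f : R -> X) : Prop :=
  exists x : X, forall e : R, 0 < e ->
    exists2 P : nat -> set R, countable_partition P &
    forall (A : nat -> set R) (t : nat -> R),
      countable_partition A -> finer A P -> choice_of_points A t ->
      let u n := fine (lambda (A n)) *: f (t n) in
      unconditionally_convergent u /\ `|x - limn (series u)| < e.

(* [phi : Lebesgue_sets R -> X], extended arbitrarily to all sets. *)
Definition sigma_additive_measure (R : realType) (X : completeNormedModType R)
    (phi : set R -> X) : Prop :=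
  forall A : nat -> set R, (forall n, Lebesgue_sets (A n)) ->
    trivIset setT A -> series (phi \o A) @ \oo --> phi (\bigcup_n A n).

Definition lambda_continuous (R : realType) (X : completeNormedModType R)
    (phi : set R -> X) : Prop :=
  forall A : set R, Lebesgue_sets A -> lambda A = 0%E -> phi A = 0.

Definition strongly_Birkhoff_integrable (R : realType)
    (X : completeNormedModType R) (f : R -> X) : Prop :=
  exists phi : set R -> X,
    [/\ sigma_additive_measure phi, lambda_continuous phi &
    forall e : R, 0 < e ->
      exists2 P : nat -> set R, countable_partition P &
      forall (A : nat -> set R) (t : nat -> R),
        countable_partition A -> finer A P -> choice_of_points A t ->
        (\sum_(0 <= n <oo)
           `|fine (lambda (A n)) *: f (t n) - phi (A n)|%:E <= e%:E)%E].

(* Main.v *)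
Require Import Defs.
From mathcomp Require Import all_boot all_order all_algebra.
From mathcomp Require Import all_classical all_reals all_analysis.
From mathcomp Require Import ring lra.

(** Strong Birkhoff integrability implies the other two properties by reading
    the defining estimate twice.  Over any admissible partition the terms
    [u n = lambda (A n) *: f (t n)] differ from [phi (A n)] by an absolutely
    summable error.  A rearrangement of a partition is a partition, and the
    values of [phi] along it sum to [phi [0, 1]], so [u] converges
    unconditionally and its sum is close to [phi [0, 1]]; this is
    [Birkhoff_of_strongly_Birkhoff].  Applying the estimate to two choices of
    points over the same partition, the second one picking in each member a
    point where [f] is far from its value at the first, bounds the measure of
    the union of the members on which [f] oscillates.  Hence [f] is uniformly
    close to a simple function off a set of small measure
    ([strongly_Birkhoff_simple_approximation]), and the Borel-Cantelli lemma
    turns a sequence of such approximations into almost everywhere convergence.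

    Conversely, strong measurability cuts [0, 1] into countably many pieces on
    which [f] is constant up to [d], apart from null pieces
    ([strongly_measurable_almost_constant]).  Let [C] be a common refinement of
    these pieces and of a partition beyond which the Birkhoff sums converge
    unconditionally, and choose points [t n] in its members.  An unconditionally convergent series
    still converges after multiplication by coefficients in [0, 1], uniformly in
    the coefficients, so that
    [nu F = \sum_n lambda (F `&` C n) *: f (t n)] is defined for all Lebesgue
    sets [F]; it is a measure because it is a uniform limit of its partial sums
    ([indefinite_sum]).  On a set [F] where [f] is within [e] of a vector [x],
    the vector [nu F] is within [(e + 2 d) * lambda F] of [lambda F *: x]: this
    is clear on the pieces of [C] and extends to their union by
    sigma-additivity.  Consequently the measures obtained for smaller and
    smaller [d] form a uniformly Cauchy sequence, and their limit [phi] has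
    [phi F] within [e * lambda F] of [lambda F *: x]
    ([indefinite_integral]).  Over a partition into almost constant pieces,
    summing this estimate gives strong Birkhoff integrability. *)

Set Implicit Arguments.
Unset Strict Implicit.
Unset Printing Implicit Defensive.

Import Order.TTheory GRing.Theory Num.Theory.
Import numFieldNormedType.Exports.

Local Open Scope classical_set_scope.
Local Open Scope ring_scope.

(** * Lebesgue measure on the unit interval *)

Section Lebesgue_measure_on_the_unit_interval.
Variable R : realType.
Implicit Types A B : set R.

Definition unit_interval : set R := `[0, 1]%classic.

Definition leb A : R := fine (lambda A).

Lemma Lebesgue_sets_unit : Lebesgue_sets unit_interval.
Proof.
split=> //; apply: sub_caratheodory; exact: measurable_itv.
Qed.

Lemma lambda_unit : lambda unit_interval = 1%E.
Proof.
have := lebesgue_measure_itv (`[0, 1] : interval R).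
by rewrite /= lte_fin ltr01 oppr0 adde0.
Qed.

Lemma Lebesgue_sets0 : @Lebesgue_sets R set0.
Proof. by split; [exact: measurable0 | exact: sub0set]. Qed.

Lemma Lebesgue_setsI A B :
  Lebesgue_sets A -> Lebesgue_sets B -> Lebesgue_sets (A `&` B).
Proof.
move=> [mA A1] [mB B1]; split; last by move=> x [/A1].
exact: (@measurableI _ (caratheodory_type (wlength idfun)^*%mu)).
Qed.

Lemma Lebesgue_setsD A B :
  Lebesgue_sets A -> Lebesgue_sets B -> Lebesgue_sets (A `\` B).
Proof.
move=> [mA A1] [mB B1]; split; last by move=> x [/A1].
exact: (@measurableD _ (caratheodory_type (wlength idfun)^*%mu)).
Qed.

Lemma Lebesgue_setsU A B :
  Lebesgue_sets A -> Lebesgue_sets B -> Lebesgue_sets (A `|` B).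
Proof.
move=> [mA A1] [mB B1]; split; last by move=> x [/A1|/B1].
exact: (@measurableU _ (caratheodory_type (wlength idfun)^*%mu)).
Qed.

Lemma Lebesgue_sets_bigcup (P : set nat) (F : nat -> set R) :
  (forall n, P n -> Lebesgue_sets (F n)) ->
  Lebesgue_sets (\bigcup_(n in P) F n).
Proof.
move=> mF; split; last by move=> x [n Pn]; exact: (mF n Pn).2.
apply: (@bigcup_measurable _ (caratheodory_type (wlength idfun)^*%mu)) => n Pn.
exact: (mF n Pn).1.
Qed.

Lemma lambdaE A : Lebesgue_sets A -> lambda A = (leb A)%:E.
Proof.
move=> [mA A1]; rewrite /leb fineK// ge0_fin_numE; last exact: measure_ge0.
apply: (@le_lt_trans _ _ (lambda unit_interval)); last by rewrite lambda_unit ltry.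
apply: le_measure; rewrite ?inE//; exact: Lebesgue_sets_unit.1.
Qed.

Lemma leb_ge0 A : 0 <= leb A.
Proof. by rewrite /leb fine_ge0// measure_ge0. Qed.

Lemma leb0 : leb set0 = 0.
Proof. by rewrite /leb measure0. Qed.

Lemma le_leb A B : Lebesgue_sets A -> Lebesgue_sets B -> A `<=` B ->
  leb A <= leb B.
Proof.
move=> mA mB AB; rewrite -lee_fin -!lambdaE//.
by apply: le_measure; rewrite ?inE//; [exact: mA.1 | exact: mB.1].
Qed.

Lemma leb_le1 A : Lebesgue_sets A -> leb A <= 1.
Proof.
move=> mA; apply: (@le_trans _ _ (leb unit_interval)).
  by apply: le_leb => //; [exact: Lebesgue_sets_unit | exact: mA.2].
by rewrite /leb lambda_unit.
Qed.

Lemma leb_setU A B : Lebesgue_sets A -> Lebesgue_sets B ->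
  A `&` B = set0 -> leb (A `|` B) = leb A + leb B.
Proof.
move=> mA mB AB0; apply: EFin_inj.
rewrite EFinD -!lambdaE//; last exact: Lebesgue_setsU.
by apply: measureU => //; [exact: mA.1 | exact: mB.1].
Qed.

Lemma leb_bigcup (F : nat -> set R) : (forall n, Lebesgue_sets (F n)) ->
  trivIset setT F -> series (leb \o F) @ \oo --> leb (\bigcup_n F n).
Proof.
move=> mF tF.
have := @measure_semi_sigma_additive _ _ _ (@completed_lebesgue_measure R) F
  (fun i => (mF i).1) tF (Lebesgue_sets_bigcup (fun n (_ : setT n) => mF n)).1.
rewrite [X in _ --> X -> _]lambdaE; last exact: Lebesgue_sets_bigcup.
move/fine_cvg; apply: cvg_trans; apply: near_eq_cvg; apply: nearW => n /=.
rewrite /series/= (eq_bigr (fun i => (leb (F i))%:E)) ?sumEFin//.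
by move=> i _; rewrite lambdaE.
Qed.

End Lebesgue_measure_on_the_unit_interval.
Arguments unit_interval {R}.

(** * Unconditional convergence *)

Section block_permutation.
Variables (h : nat -> nat) (Q : nat -> pred nat).
Hypothesis h_gt : forall m, (m < h m)%N.

(** The blocks are the intervals [[a, h a)] with [a = 0] or [a = h a'] for the
    start [a'] of the preceding block; [block_start m] is the start of the block
    containing [m]. *)
Fixpoint block_start m : nat :=
  if m is k.+1 then
    if k.+1 == h (block_start k) then k.+1 else block_start k
  else 0%N.

Lemma block_start_bounds m :
  (block_start m <= m < h (block_start m))%N.
Proof.
elim: m => [|m /andP[le_m lt_m]] /=; first exact: h_gt.
case: ifPn => [_|ne]; first by rewrite leqnn h_gt.
by rewrite (leq_trans le_m)//= ltn_neqAle ne.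
Qed.

Lemma block_start_eq m k :
  (block_start m <= k < h (block_start m))%N -> block_start k = block_start m.
Proof.
have idem : block_start (block_start m) = block_start m.
  by elim: m => //= m IHm; case: ifPn => [/= ->|].
move=> /andP[/subnKC <-]; elim: (k - _)%N => [|d IHd]; first by rewrite addn0.
rewrite addnS => lt_d /=; rewrite IHd; last exact: ltnW.
by rewrite ltn_eqF.
Qed.

Lemma block_start_next m :
  block_start (h (block_start m)) = h (block_start m).
Proof.
have /andP[le_m lt_m] := block_start_bounds m.
have lt_h := h_gt (block_start m).
have hE : (h (block_start m)).-1.+1 = h (block_start m).
  by rewrite prednK// (leq_ltn_trans _ lt_h).
rewrite -{1}hE /= (@block_start_eq m) ?hE ?eqxx//.
by rewrite -ltnS hE lt_h leqnn.
Qed.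

Let block a := iota a (h a - a).
Let sorted_block a := seq.filter (Q a) (block a) ++ seq.filter (predC (Q a)) (block a).

Let mem_sorted_block a i : (i \in sorted_block a) = (a <= i < h a)%N.
Proof.
have /perm_mem -> : perm_eq (sorted_block a) (block a) by rewrite perm_filterC.
by rewrite mem_iota subnKC// ltnW.
Qed.

Let size_sorted_block a : size (sorted_block a) = (h a - a)%N.
Proof.
have /perm_size -> : perm_eq (sorted_block a) (block a) by rewrite perm_filterC.
by rewrite size_iota.
Qed.

Let uniq_sorted_block a : uniq (sorted_block a).
Proof.
have /perm_uniq -> : perm_eq (sorted_block a) (block a) by rewrite perm_filterC.
exact: iota_uniq.
Qed.

Let perm m := nth 0%N (sorted_block (block_start m)) (m - block_start m).

Let pmer m := (block_start m + index m (sorted_block (block_start m)))%N.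

Let offset m : (m - block_start m < h (block_start m) - block_start m)%N.
Proof.
have /andP[le_m lt_m] := block_start_bounds m.
by rewrite ltn_sub2r// h_gt.
Qed.

(** Sorting each block so that the indices selected by [Q] come first only
    moves indices inside their block, hence is a permutation of [nat].  It turns
    a sum over selected indices into a sum over consecutive ones. *)
Lemma block_permutation : exists2 s : nat -> nat, bijective s &
  forall M, exists2 a, (M <= a)%N & exists k,
    map s (iota a k) = seq.filter (Q a) (iota a (h a - a)).
Proof.
exists perm; first exists pmer.
- move=> m; have perm_m : block_start (perm m) = block_start m.
    apply: block_start_eq; rewrite -mem_sorted_block mem_nth//.
    by rewrite size_sorted_block offset.
  rewrite /pmer perm_m index_uniq ?size_sorted_block ?offset//.
  by rewrite subnKC//; case/andP: (block_start_bounds m).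
- move=> m; have m_in : m \in sorted_block (block_start m).
    by rewrite mem_sorted_block block_start_bounds.
  have pmer_m : block_start (pmer m) = block_start m.
    apply: block_start_eq; rewrite leq_addr/= -ltn_subRL.
    by rewrite -size_sorted_block index_mem.
  by rewrite /perm pmer_m /pmer addKn nth_index.
move=> M; exists (h (block_start M)).
  by apply: ltnW; case/andP: (block_start_bounds M).
set a := h _; exists (size (seq.filter (Q a) (block a))).
have a_start : block_start a = a by exact: block_start_next.
apply: (@eq_from_nth _ 0%N) => [|i]; first by rewrite size_map size_iota.
rewrite size_map size_iota => lt_i.
rewrite (nth_map 0%N) ?size_iota// nth_iota//.
have start_i : block_start (a + i) = a.
  rewrite -{2}a_start; apply: block_start_eq; rewrite a_start leq_addr/=.
  rewrite -ltn_subRL (leq_trans lt_i)// size_filter.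
  by rewrite (leq_trans (count_size _ _))// size_iota.
by rewrite /perm start_i addKn nth_cat lt_i.
Qed.

End block_permutation.

Section unordered_summation.
Context (R : realType) (X : completeNormedModType R).
Implicit Types (u : nat -> X) (Q : pred nat).

Definition unordered_cauchy u := forall e : R, 0 < e -> exists N, forall Q n,
  `|\sum_(N <= i < n | Q i) u i| < e.

(** If arbitrarily far finite subsums were large, they would occur in
    successive blocks of indices; permuting each block to make its large subsum
    contiguous gives a rearrangement whose partial sums are not Cauchy. *)
Lemma unconditionally_convergent_unordered_cauchy u :
  unconditionally_convergent u -> unordered_cauchy u.
Proof.
move=> ucu; apply: contrapT => /existsNP[e] /not_implyP[e0] /forallNP far.
have /choice[F FP] : forall N, exists Qn : pred nat * nat,
    e <= `|\sum_(N <= i < Qn.2 | Qn.1 i) u i|.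
  move=> N; have /existsNP[Q /existsNP[n /negP]] := far N.
  by rewrite -leNgt => ?; exists (Q, n).
(* The bad sum over [N <= i < (F N).2] is nonzero, hence nonempty. *)
have F_gt N : (N < (F N).2)%N.
  rewrite ltnNge; apply/negP => le_N.
  by have := FP N; rewrite big_geq// normr0 leNgt e0.
have [s bij_s blocks] := block_permutation (fun N => (F N).1) F_gt.
have /cauchy_cvgP/cauchy_seriesP/(_ e e0) := ucu s bij_s.
case=> [[U V] /= [[M _ MU] [M' _ M'V]] UV].
have [a Ma [k sE]] := blocks (maxn M M').
have sumE : \sum_(a <= i < a + k) (u \o s) i =
    \sum_(a <= i < (F a).2 | (F a).1 i) u i.
  by rewrite /index_iota addKn -(big_map s xpredT u) sE big_filter.
have : `|\sum_(a <= i < (F a).2 | (F a).1 i) u i| < e.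
  rewrite -sumE; apply: (UV (a, a + k)%N); split => /=.
    by apply: MU; exact: leq_trans (leq_maxl _ _) Ma.
  apply: M'V; apply: leq_trans (leq_addr _ _).
  exact: leq_trans (leq_maxr _ _) Ma.
by rewrite ltNge FP.
Qed.

(** The sum is affine in each coefficient, so its norm is convex in it and is
    largest when all the coefficients are [0] or [1]. *)
Lemma norm_sum_multiplier_le (r : seq nat) u (c : nat -> R) (v : X) (e : R) :
  uniq r -> (forall i, 0 <= c i <= 1) ->
  (forall Q, `|v + \sum_(i <- r | Q i) u i| <= e) ->
  `|v + \sum_(i <- r) c i *: u i| <= e.
Proof.
move=> + c01; elim: r v => [|a r IHr] v /=; first by move=> _ /(_ xpredT); rewrite !big_nil.
move=> /andP[ar ur] small; rewrite big_cons.
have small0 : `|v + \sum_(i <- r) c i *: u i| <= e.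
  apply: IHr => // Q; have := small (fun i => (i != a) && Q i).
  rewrite big_cons eqxx/= big_seq_cond.
  rewrite (eq_bigl (fun i => (i \in r) && Q i)) -?big_seq_cond// => i.
  by case: (boolP (i \in r)) => //= ir; rewrite (memPn ar).
have small1 : `|v + u a + \sum_(i <- r) c i *: u i| <= e.
  apply: IHr => // Q; have := small (fun i => (i == a) || Q i).
  rewrite big_cons eqxx/= addrA big_seq_cond.
  rewrite (eq_bigl (fun i => (i \in r) && Q i)) -?big_seq_cond// => i.
  by case: (boolP (i \in r)) => //= ir; rewrite (negbTE (memPn ar _ ir)).
have /andP[c0 c1] := c01 a.
set w := \sum_(i <- r) _.
have -> : v + (c a *: u a + w) = (1 - c a) *: (v + w) + c a *: (v + u a + w).
  rewrite (addrAC v (u a) w) (scalerDr (c a) (v + w)) [RHS]addrA -scalerDl.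
  by rewrite subrK scale1r addrCA addrC.
rewrite (le_trans (ler_normD _ _))// !normrZ !ger0_norm ?subr_ge0//.
rewrite (@le_trans _ _ ((1 - c a) * e + c a * e))//.
  by rewrite lerD// ler_wpM2l// subr_ge0.
by rewrite -mulrDl subrK mul1r.
Qed.

(** The tails are small uniformly in the coefficients; for
    [c i = lambda (F `&` A i) / lambda (A i)] this is uniformity in the set
    [F]. *)
Lemma unordered_cauchy_multiplier u : unordered_cauchy u ->
  forall e, 0 < e -> exists N, forall c n, (forall i, 0 <= c i <= 1) ->
  `|\sum_(N <= i < n) c i *: u i| <= e.
Proof.
move=> ucu e e0; have [N NP] := ucu e e0; exists N => c n c01.
rewrite -[X in `|X|]add0r; apply: norm_sum_multiplier_le => //.
  exact: iota_uniq.
by move=> Q; rewrite add0r ltW.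
Qed.

End unordered_summation.

(** * Absolutely continuous vector measures *)

Lemma le_cvg_seq (R : realType) (u v : nat -> R) (a b : R) :
  u @ \oo --> a -> v @ \oo --> b -> (\forall n \near \oo, u n <= v n) -> a <= b.
Proof.
move=> ua vb uv; rewrite -(cvg_lim _ ua)// -(cvg_lim _ vb)//.
by apply: ler_lim => //; [apply/cvg_ex; exists a | apply/cvg_ex; exists b].
Qed.

Section additive_set_functions.
Context (R : realType).

Definition Lebesgue_additive (G : zmodType) (mu : set R -> G) :=
  forall A B, Lebesgue_sets A -> Lebesgue_sets B -> A `&` B = set0 ->
    mu (A `|` B) = mu A + mu B.

Lemma Lebesgue_additive0 (G : zmodType) (mu : set R -> G) :
  Lebesgue_additive mu -> mu set0 = 0.
Proof.
move=> addmu; have := addmu set0 set0 (@Lebesgue_sets0 R) (@Lebesgue_sets0 R).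
by rewrite setU0 setI0 => /(_ erefl)/esym/eqP; rewrite -subr_eq0 addrK => /eqP.
Qed.

Lemma Lebesgue_additiveD (G : zmodType) (mu : set R -> G) A B :
  Lebesgue_additive mu -> Lebesgue_sets A -> Lebesgue_sets B -> B `<=` A ->
  mu A = mu B + mu (A `\` B).
Proof.
move=> addmu mA mB BA; rewrite -addmu ?setDUK// ?setDIK//.
exact: Lebesgue_setsD.
Qed.

Lemma Lebesgue_sets_bigU (F : nat -> set R) n :
  (forall i, Lebesgue_sets (F i)) -> Lebesgue_sets (\big[setU/set0]_(i < n) F i).
Proof.
move=> mF; elim: n => [|n IHn]; first by rewrite big_ord0; exact: Lebesgue_sets0.
by rewrite big_ord_recr; exact: Lebesgue_setsU.
Qed.

Lemma Lebesgue_additive_series (G : zmodType) (mu : set R -> G) (F : nat -> set R) n :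
  Lebesgue_additive mu -> (forall i, Lebesgue_sets (F i)) -> trivIset setT F ->
  series (mu \o F) n = mu (\big[setU/set0]_(i < n) F i).
Proof.
move=> addmu mF tF; elim: n => [|n IHn].
  by rewrite big_ord0 Lebesgue_additive0// /series/= big_geq.
rewrite seriesSr IHn big_ord_recr/= addmu//; first exact: Lebesgue_sets_bigU.
rewrite -bigcup_mkord setI_bigcupl bigcup0// => i /= ltin.
by move/trivIsetP : tF; apply=> //; rewrite ltn_eqF.
Qed.

End additive_set_functions.

Section absolutely_continuous_measures.
Context (R : realType) (X : completeNormedModType R).
Implicit Types (mu nu : set R -> X) (A B F : set R).

(** The second clause bounds [mu], up to any error [e], by a multiple of
    [lambda].  This form of [lambda]-absolute continuity passes to uniform
    limits and, for additive set functions, implies sigma-additivity. *)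
Definition absolutely_continuous mu := Lebesgue_additive mu /\
  forall e : R, 0 < e -> exists K : R, forall F, Lebesgue_sets F ->
    `|mu F| <= e + K * leb F.

(** The partial sums miss the value of [mu] on the tail of the union, whose
    Lebesgue measure tends to [0]. *)
Lemma absolutely_continuous_sigma_additive mu :
  absolutely_continuous mu -> sigma_additive_measure mu.
Proof.
move=> [addmu cmu] A mA tA.
have mUA : Lebesgue_sets (\bigcup_n A n) by exact: Lebesgue_sets_bigcup.
pose T n := (\bigcup_n A n) `\` \big[setU/set0]_(i < n) A i.
have mT n : Lebesgue_sets (T n).
  by apply: Lebesgue_setsD => //; exact: Lebesgue_sets_bigU.
have subU n : \big[setU/set0]_(i < n) A i `<=` \bigcup_n A n.
  by rewrite -bigcup_mkord; exact: bigcup_subset.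
have lebT : leb (T n) @[n --> \oo] --> (0 : R).
  have -> : (fun n => leb (T n)) =
      (fun n => leb (\bigcup_n A n) - series (@leb R \o A) n).
    apply/funext => n.
    have -> := Lebesgue_additive_series n (@leb_setU R) mA tA.
    have mBig := Lebesgue_sets_bigU n mA.
    have -> := Lebesgue_additiveD (@leb_setU R) mUA mBig (subU n).
    by rewrite addrAC subrr add0r.
  rewrite -[X in _ --> X](subrr (leb (\bigcup_n A n))).
  by apply: cvgB; [exact: cvg_cst | exact: leb_bigcup].
apply/cvgrPdist_le => e e0.
have [K muK] := cmu (e / 2) (divr_gt0 e0 (ltr0Sn _ 1)).
have KT : K * leb (T n) @[n --> \oo] --> (0 : R).
  by rewrite -(mulr0 K); exact: cvgMr.
have /cvgrPdist_le/(_ (e / 2) (divr_gt0 e0 (ltr0Sn _ 1))) := KT.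
apply: filterS => n; rewrite sub0r normrN => KTe.
rewrite (Lebesgue_additive_series _ addmu mA tA).
rewrite (Lebesgue_additiveD addmu mUA _ (subU n)); last exact: Lebesgue_sets_bigU.
rewrite addrAC subrr add0r (le_trans (muK _ (mT n)))// [leRHS](splitr e) lerD2l.
exact: le_trans (ler_norm _) KTe.
Qed.

Lemma absolutely_continuous_null mu A : absolutely_continuous mu ->
  Lebesgue_sets A -> leb A = 0 -> mu A = 0.
Proof.
move=> [_ cmu] mA A0; apply/eqP; rewrite -normr_eq0 eq_le normr_ge0 andbT.
apply/ler_addgt0Pl => e e0; have [K /(_ A mA)] := cmu e e0.
by rewrite A0 mulr0.
Qed.

Lemma absolutely_continuous_approx mu :
  (forall e : R, 0 < e -> exists2 nu, absolutely_continuous nu &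
    forall F, Lebesgue_sets F -> `|nu F - mu F| <= e) ->
  absolutely_continuous mu.
Proof.
move=> approx; split=> [A B mA mB AB0|e e0]; last first.
  have [nu [addnu cnu] numu] := approx (e / 2) (divr_gt0 e0 (ltr0Sn _ 1)).
  have [K nuK] := cnu (e / 2) (divr_gt0 e0 (ltr0Sn _ 1)).
  exists K => F mF; rewrite [X in X + _](splitr e) -addrA.
  rewrite -[mu F](subrK (nu F)) (le_trans (ler_normD _ _))// lerD//.
    by rewrite distrC numu.
  exact: nuK.
apply/eqP; rewrite -subr_eq0 -normr_le0; apply/ler_addgt0Pl => e e0.
rewrite addr0.
have [nu [addnu _] numu] := approx (e / 3) (divr_gt0 e0 (ltr0Sn _ 2)).
have mAB := Lebesgue_setsU mA mB.
have -> : mu (A `|` B) - (mu A + mu B) =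
    (mu (A `|` B) - nu (A `|` B)) + ((nu A - mu A) + (nu B - mu B)).
  by rewrite (addnu A B)// [X in _ = _ + X]addrACA -opprD addrA subrK.
apply: le_trans (ler_normD _ _) _; rewrite [leRHS](_ : e = e / 3 + (e / 3 + e / 3)).
  apply: lerD; first by rewrite distrC numu.
  by apply: le_trans (ler_normD _ _) _; apply: lerD; exact: numu.
by lra.
Qed.

(** The limit is taken pointwise; the Cauchy condition is uniform in [F], so
    the convergence is too, and additivity and absolute continuity survive. *)
Lemma absolutely_continuous_complete (mu_ : nat -> set R -> X) :
  (forall n, absolutely_continuous (mu_ n)) ->
  (forall e : R, 0 < e -> exists N, forall n, (N <= n)%N ->
    forall F, Lebesgue_sets F -> `|mu_ N F - mu_ n F| <= e) ->
  exists2 mu, absolutely_continuous mu & forall F, Lebesgue_sets F ->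
    mu_ ^~ F @ \oo --> mu F.
Proof.
move=> acmu cauchymu.
have cvmu F : Lebesgue_sets F -> mu_ ^~ F @ \oo --> limn (mu_ ^~ F).
  move=> mF; apply/cauchy_cvgP/cauchy_exP => e e0.
  have [N NP] := cauchymu (e / 2) (divr_gt0 e0 (ltr0Sn _ 1)).
  exists (mu_ N F); exists N => // n /= Nn; rewrite -ball_normE/=.
  by rewrite (le_lt_trans (NP n Nn F mF))// ltr_pdivrMr// ltr_pMr// ltr1n.
exists (fun F => limn (mu_ ^~ F)) => //.
apply: absolutely_continuous_approx => e e0.
have [N NP] := cauchymu e e0; exists (mu_ N) => // F mF.
apply: (@le_cvg_seq _ (fun n => `|mu_ N F - mu_ n F|) (cst e)).
- by apply: cvg_norm; apply: cvgB; [exact: cvg_cst | exact: cvmu].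
- exact: cvg_cst.
by exists N => // n /= Nn; exact: NP.
Qed.

(** A bound by a multiple of [lambda] can be checked on the pieces of a
    partition, since both sides are sigma-additive. *)
Lemma absolutely_continuous_bound mu (P : nat -> set R) (c : R) F :
  absolutely_continuous mu -> countable_partition P -> Lebesgue_sets F ->
  (forall n, `|mu (F `&` P n)| <= c * leb (F `&` P n)) ->
  `|mu F| <= c * leb F.
Proof.
move=> acmu [mP tP UP] mF small.
have mFP n : Lebesgue_sets (F `&` P n) by exact: Lebesgue_setsI.
have tFP : trivIset setT (fun n => F `&` P n) by exact: trivIset_setIl.
have UFP : \bigcup_n (F `&` P n) = F.
  by rewrite -setI_bigcupr UP; apply/setIidl; exact: mF.2.
have cvmu := absolutely_continuous_sigma_additive acmu mFP tFP.
have cvleb := leb_bigcup mFP tFP; rewrite UFP in cvmu cvleb.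
apply: (@le_cvg_seq _ (fun n => `|series (mu \o (fun n => F `&` P n)) n|)
  (fun n => c * series (@leb R \o (fun n => F `&` P n)) n)).
- exact: cvg_norm cvmu.
- exact: cvgMr.
apply: nearW => n; rewrite /series/= mulr_sumr (le_trans (ler_norm_sum _ _ _))//.
by apply: ler_sum => i _; exact: small.
Qed.

End absolutely_continuous_measures.

(** * Indefinite sums *)

Section indefinite_sums.
Context (R : realType) (X : completeNormedModType R).
Implicit Types (mu nu : set R -> X) (A B F : set R).

Lemma absolutely_continuousD mu nu : absolutely_continuous mu ->
  absolutely_continuous nu -> absolutely_continuous (fun F => mu F + nu F).
Proof.
move=> [addmu cmu] [addnu cnu]; split=> [A B mA mB AB0|e e0].
  by rewrite addmu// addnu// addrACA.
have [K muK] := cmu (e / 2) (divr_gt0 e0 (ltr0Sn _ 1)).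
have [L nuL] := cnu (e / 2) (divr_gt0 e0 (ltr0Sn _ 1)).
exists (K + L) => F mF; rewrite (le_trans (ler_normD _ _))//.
by rewrite {1}(splitr e) mulrDl addrACA lerD ?muK ?nuL.
Qed.

Lemma absolutely_continuousN mu : absolutely_continuous mu ->
  absolutely_continuous (fun F => - mu F).
Proof.
move=> [addmu cmu]; split=> [A B mA mB AB0|e e0]; first by rewrite addmu// opprD.
by have [K muK] := cmu e e0; exists K => F mF; rewrite normrN muK.
Qed.

Lemma absolutely_continuousB mu nu : absolutely_continuous mu ->
  absolutely_continuous nu -> absolutely_continuous (fun F => mu F - nu F).
Proof.
by move=> amu anu; apply: absolutely_continuousD => //; exact: absolutely_continuousN.
Qed.

Lemma absolutely_continuous_lebI A (x : X) : Lebesgue_sets A ->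
  absolutely_continuous (fun F => leb (F `&` A) *: x).
Proof.
move=> mA; split=> [B C mB mC BC0|e e0].
  rewrite setIUl leb_setU ?scalerDl//; [exact: Lebesgue_setsI..|].
  by rewrite setIACA BC0 set0I.
exists `|x| => F mF; rewrite normrZ ger0_norm ?leb_ge0// mulrC.
apply: ler_wpDl; first exact: ltW.
apply: ler_wpM2l => //; apply: le_leb => //; exact: Lebesgue_setsI.
Qed.

Lemma absolutely_continuous_sum (mu_ : nat -> set R -> X) n :
  (forall i, absolutely_continuous (mu_ i)) ->
  absolutely_continuous (fun F => \sum_(0 <= i < n) mu_ i F).
Proof.
move=> amu; elim: n => [|n IHn].
  suff -> : (fun F => \sum_(0 <= i < 0) mu_ i F) = (fun F => mu_ 0%N F - mu_ 0%N F).
    exact: absolutely_continuousB.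
  by apply/funext => F; rewrite big_geq// subrr.
suff -> : (fun F => \sum_(0 <= i < n.+1) mu_ i F) =
  (fun F => \sum_(0 <= i < n) mu_ i F + mu_ n F) by exact: absolutely_continuousD.
by apply/funext => F; rewrite big_nat_recr.
Qed.

(** The measure is [F |-> \sum_n lambda (F `&` A n) *: x n], the indefinite
    integral of the function equal to [x n] on [A n]. *)
Lemma indefinite_sum (A : nat -> set R) (x : nat -> X) :
  countable_partition A -> unordered_cauchy (fun n => leb (A n) *: x n) ->
  exists2 mu, absolutely_continuous mu & forall n F, Lebesgue_sets F ->
    F `<=` A n -> mu F = leb F *: x n.
Proof.
move=> [mA tA UA] uc.
pose mu_ N F := \sum_(0 <= i < N) leb (F `&` A i) *: x i.
have amu N : absolutely_continuous (mu_ N).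
  by apply: absolutely_continuous_sum => i; exact: absolutely_continuous_lebI.
have [e e0|mu acmu cvmu] := absolutely_continuous_complete amu.
  have [N NP] := unordered_cauchy_multiplier uc e0.
  exists N => n Nn F mF.
  (* [F] enters the tail only through the multipliers [c i]. *)
  rewrite distrC /mu_ (big_cat_nat (leq0n N) Nn)/= addrAC subrr add0r.
  pose c i := leb (F `&` A i) / leb (A i).
  have lebIA i : leb (F `&` A i) <= leb (A i).
    by apply: le_leb => //; exact: Lebesgue_setsI.
  have c01 i : 0 <= c i <= 1.
    rewrite /c divr_ge0 ?leb_ge0//=; have [->|Ai0] := eqVneq (leb (A i)) 0.
      by rewrite invr0 mulr0 ler01.
    by rewrite ler_pdivrMr ?mul1r// lt_neqAle eq_sym Ai0 leb_ge0.
  rewrite (eq_bigr (fun i => c i *: (leb (A i) *: x i))) ?NP// => i _.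
  rewrite scalerA /c; have [Ai0|Ai0] := eqVneq (leb (A i)) 0; last by rewrite divfK.
  by rewrite Ai0 mulr0 (@le_anti _ _ (leb _) 0)// leb_ge0 andbT -Ai0 lebIA.
exists mu => // n F mF FA; rewrite -(cvg_lim _ (cvmu F mF))//.
apply: lim_near_cst => //; exists n.+1 => // N /= nN.
rewrite /mu_ (bigD1_seq n) ?mem_iota ?iota_uniq//=; last by rewrite subn0.
rewrite (setIidl FA) big1 ?addr0// => i /eqP ni.
suff -> : F `&` A i = set0 by rewrite leb0 scale0r.
rewrite -subset0 => y [/FA yn yi]; apply: ni.
by apply: tA => //; exists y.
Qed.

End indefinite_sums.

(** * Partitions on which a strongly measurable function is almost constant *)

Section countable_covers.
Variable R : realType.

Lemma unit_interval0 : @unit_interval R 0.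
Proof. by rewrite /unit_interval/= in_itv/= lexx ler01. Qed.

(** Indexing by a [countType] serves covers that are naturally indexed by pairs
    or options of naturals. *)
Lemma countable_cover_refinement (I : countType) (U : I -> set R) :
  (forall i, Lebesgue_sets (U i)) -> unit_interval `<=` \bigcup_i U i ->
  exists2 A, countable_partition A & forall n, exists i, A n `<=` U i.
Proof.
move=> mU cover; pose V n := if unpickle n is Some i then U i else set0.
have mV n : Lebesgue_sets (V n).
  by rewrite /V; case: unpickle => [i|]; [exact: mU | exact: Lebesgue_sets0].
exists (seqDU V) => [|n].
  split; [move=> n| exact: trivIset_seqDU|].
    apply: Lebesgue_setsD => //.
    exact: Lebesgue_sets_bigU.
  rewrite -seqDU_bigcup_eq eqEsubset; split=> [x [n _]|x x01].
    exact: (mV n).2.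
  have [i _ Uix] := cover x x01; exists (pickle i) => //.
  by rewrite /V pickleK.
have : seqDU V n `<=` V n by exact: subset_seqDU.
rewrite /V; case: unpickle => [i|sub0]; first by exists i.
have [i _ _] := cover 0 unit_interval0; exists i.
by move=> x /sub0.
Qed.

Lemma common_refinement (P Q : nat -> set R) :
  countable_partition P -> countable_partition Q ->
  exists2 A, countable_partition A & finer A P /\ finer A Q.
Proof.
move=> [mP _ UP] [mQ _ UQ].
pose U (ij : nat * nat) := P ij.1 `&` Q ij.2.
have [||A pA AU] := @countable_cover_refinement _ U.
- by move=> ij; exact: Lebesgue_setsI.
- move=> x x01; have [i _ Pix] : (\bigcup_n P n) x by rewrite UP.
  by have [j _ Qjx] : (\bigcup_n Q n) x by [rewrite UQ]; exists (i, j).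
by exists A => //; split=> n; have [[i j] AUij] := AU n; [exists i|exists j];
  move=> x /AUij[].
Qed.

Lemma choice_of_points_exists (A : nat -> set R) :
  exists t, choice_of_points A t.
Proof.
suff /choice : forall n, exists x, A n !=set0 -> A n x.
  by move=> [t tP]; exists t.
move=> n; have [[x Ax]|A0] := pselect (A n !=set0); first by exists x.
by exists 0.
Qed.

End countable_covers.

Section small_oscillation.
Context (R : realType) (X : completeNormedModType R).
Implicit Types (f s : R -> X) (A : set R).

Definition almost_constant f (d : R) A :=
  leb A = 0 \/ exists y, forall x, A x -> `|f x - y| <= d.

Lemma simple_measurable_preimage s (Y : set X) : simple_measurable s ->
  Lebesgue_sets (unit_interval `&` s @^-1` Y).
Proof.
move=> [/finite_seqP[r rE] ms].
have -> : unit_interval `&` s @^-1` Y =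
    \bigcup_(i in [set i | Y (nth 0 r i)])
      (unit_interval `&` s @^-1` [set nth 0 r i]).
  rewrite eqEsubset; split=> [x [x01 Ysx]|x [i Yi [x01 /= ->]]]; last by [].
  have : [set` r] (s x) by rewrite -rE; exists x.
  by move=> /= sxr; exists (index (s x) r) => /=; rewrite nth_index.
by apply: Lebesgue_sets_bigcup => i _; exact: ms.
Qed.

(** Let [s l] be simple functions converging to [f] off a null set, which is one
    of the pieces.  At any other point [x] some [s j] stays within [d] of all
    later [s l]; so [x] lies in the set where all [s l] with [l >= j] are within
    [d] of the vector [s j x], one of the finitely many values of [s j].  These
    sets, indexed by [j] and by the values of [s j], are defined by simple
    functions only, hence measurable, and [f] is within [d] of the value on
    each. *)
Lemma strongly_measurable_almost_constant f (d : R) :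
  strongly_measurable f -> 0 < d -> exists2 P, countable_partition P &
    forall n, almost_constant f d (P n).
Proof.
move=> [s [ms [N [mN N0 sf]]]] d0.
have m01 := @Lebesgue_sets_unit R.
pose N1 := unit_interval `&` N.
have mN1 : Lebesgue_sets N1.
  split; last exact: subIsetl.
  apply: (@measurableI _ (caratheodory_type (wlength idfun)^*%mu)) => //.
  exact: m01.1.
have N10 : leb N1 = 0.
  apply/eqP; rewrite eq_le leb_ge0 andbT -lee_fin -lambdaE//.
  rewrite -[leRHS]N0; apply: le_measure; rewrite ?inE//; first exact: mN1.1.
  exact: subIsetr.
have /choice[r rE] : forall j, exists r : seq X, s j @` `[0, 1]%classic = [set` r].
  by move=> j; apply/finite_seqP; exact: (ms j).1.
(* [None] indexes the null set. *)
pose U (o : option (nat * nat)) := if o is Some (j, i) then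
  (unit_interval `\` N1) `\` \bigcup_(l in [set l | (j <= l)%N])
    (unit_interval `&` s l @^-1` [set v | d < `|v - nth 0 (r j) i|])
  else N1.
have [||P pP PU] := @countable_cover_refinement _ _ U.
- case=> [[j i]|//]; apply: Lebesgue_setsD; first exact: Lebesgue_setsD.
  by apply: Lebesgue_sets_bigcup => l _; exact: simple_measurable_preimage.
- move=> x x01; have [N1x|N1x] := pselect (N1 x); first by exists None.
  have : s ^~ x @ \oo --> f x.
    by apply: contrapT => nsf; apply: N1x; split => //; apply: sf => /(_ x01).
  move=> /cvgrPdist_lt/(_ (d / 2) (divr_gt0 d0 (ltr0Sn _ 1)))[j _ jP].
  have : [set` r j] (s j x) by rewrite -rE; exists x.
  move=> /= sjx; exists (Some (j, index (s j x) (r j))) => //; split => //.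
  move=> [l /= jl [_]]; rewrite nth_index//; apply/negP; rewrite -leNgt.
  rewrite [leRHS](splitr d) -(subrKA (f x)).
  rewrite (le_trans (ler_normD _ _))// lerD//; last by rewrite ltW// jP/=.
  by rewrite distrC ltW// jP.
exists P => // n; have [[[j i] PUn|PUn]] := PU n; last first.
  left; apply/eqP; rewrite eq_le leb_ge0 andbT -N10 le_leb//.
  by case: pP.
right; exists (nth 0 (r j) i) => x /PUn[[x01 N1x] far].
have sfx : s ^~ x @ \oo --> f x.
  by apply: contrapT => nsf; apply: N1x; split => //; apply: sf => /(_ x01).
apply: (@le_cvg_seq _ (fun l => `|s l x - nth 0 (r j) i|) (cst d)).
- by apply: cvg_norm; apply: cvgB => //; exact: cvg_cst.
- exact: cvg_cst.
exists j => // l /= jl; rewrite leNgt; apply/negP => dl; apply: far.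
by exists l.
Qed.

End small_oscillation.

(** * The indefinite integral *)

Section indefinite_integral.
Context (R : realType) (X : completeNormedModType R).
Implicit Types (f : R -> X) (mu nu phi : set R -> X) (F : set R).

(** The indefinite integral of [f] is characterized by its values on sets where
    [f] is nearly constant; [c] is the error allowed per unit of Lebesgue
    measure. *)
Definition integral_up_to f (c : R) mu := absolutely_continuous mu /\
  forall F (x : X) (d : R), Lebesgue_sets F ->
    (forall s, F s -> `|f s - x| <= d) ->
    `|mu F - leb F *: x| <= (d + c) * leb F.

(** Replace [f] by the function that is constant on each piece of a fine
    enough partition, with value taken at a point of the piece, and integrate it
    by [indefinite_sum]. *)
Lemma approximate_indefinite_integral f (P : nat -> set R) (d : R) :
  strongly_measurable f -> countable_partition P ->
  (forall A t, countable_partition A -> finer A P -> choice_of_points A t ->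
    unconditionally_convergent (fun n => leb (A n) *: f (t n))) ->
  0 < d -> exists nu, integral_up_to f (d *+ 2) nu.
Proof.
move=> sf pP ucP d0.
have [B pB Bd] := strongly_measurable_almost_constant sf d0.
have [C pC [CP CB]] := common_refinement pP pB.
have [t tC] := choice_of_points_exists C.
have [nu acnu nuC] := indefinite_sum pC
  (unconditionally_convergent_unordered_cauchy (ucP C t pC CP tC)).
exists nu; split=> // F x e mF Fx.
have mC n : Lebesgue_sets (C n) by case: pC.
have mB n : Lebesgue_sets (B n) by case: pB.
pose mu G := nu G - leb (G `&` unit_interval) *: x.
have muE G : Lebesgue_sets G -> mu G = nu G - leb G *: x.
  by move=> mG; rewrite /mu (setIidl mG.2).
rewrite -muE//; apply: (absolutely_continuous_bound _ pC) => //.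
  apply: absolutely_continuousB => //.
  by apply: absolutely_continuous_lebI; exact: Lebesgue_sets_unit.
move=> n; set G := F `&` C n.
have mG : Lebesgue_sets G by exact: Lebesgue_setsI.
rewrite muE// (nuC n G mG) -?scalerBr; last exact: subIsetr.
rewrite normrZ ger0_norm ?leb_ge0// mulrC.
have [->|Gn0] := eqVneq (leb G) 0; first by rewrite !mulr0.
have [m CBm] := CB n; have [Bm0|[y By]] := Bd m.
  case/negP: Gn0; rewrite eq_le leb_ge0 andbT -Bm0 le_leb//.
  by apply: subset_trans CBm; exact: subIsetr.
have [s [Fs Cs]] : G !=set0.
  by apply/set0P; apply: contra_neq Gn0 => ->; exact: leb0.
apply: ler_wpM2r; first exact: leb_ge0.
have -> : f (t n) - x = (f s - x) + ((f (t n) - y) + (y - f s)).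
  by rewrite subrKA [RHS]addrC subrKA.
rewrite (le_trans (ler_normD _ _))// lerD ?Fx// (le_trans (ler_normD _ _))//.
rewrite mulr2n lerD ?[`|y - _|]distrC//; apply: By; apply: CBm => //.
by apply: tC; exists s.
Qed.

(** On a set where [f] is nearly constant, both measures are close to
    [lambda] times that constant; such sets and null sets partition the unit
    interval. *)
Lemma integral_up_to_close f (c c' : R) mu nu :
  strongly_measurable f -> integral_up_to f c mu -> integral_up_to f c' nu ->
  forall F, Lebesgue_sets F -> `|mu F - nu F| <= (c + c') * leb F.
Proof.
move=> sf [acmu muf] [acnu nuf] F mF; apply/ler_addgt0Pl => e e0.
have [B pB Be] := strongly_measurable_almost_constant sf (divr_gt0 e0 (ltr0Sn _ 1)).
have mB n : Lebesgue_sets (B n) by case: pB.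
apply: (@le_trans _ _ ((e + (c + c')) * leb F)); last first.
  by rewrite mulrDl lerD2r -[leRHS]mulr1 (ler_wpM2l (ltW e0))// leb_le1.
apply: (absolutely_continuous_bound (mu := fun G => mu G - nu G) _ pB) => //.
  exact: absolutely_continuousB.
move=> n; set G := F `&` B n.
have mG : Lebesgue_sets G by exact: Lebesgue_setsI.
have [B0|[y By]] := Be n.
  have G0 : leb G = 0.
    by apply/eqP; rewrite eq_le leb_ge0 andbT -B0 le_leb//; exact: subIsetr.
  rewrite (absolutely_continuous_null acmu mG G0).
  by rewrite (absolutely_continuous_null acnu mG G0) subrr normr0 G0 mulr0.
have Gy s : G s -> `|f s - y| <= e / 2 by move=> [_]; exact: By.
rewrite -(subrKA (leb G *: y)) (le_trans (ler_normD _ _))//.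
rewrite [`|_ *: y - _|]distrC (le_trans (lerD (muf _ _ _ mG Gy) (nuf _ _ _ mG Gy)))//.
by rewrite -mulrDl addrACA -splitr.
Qed.

Lemma indefinite_integral f : strongly_measurable f -> Birkhoff_integrable f ->
  exists phi, integral_up_to f 0 phi.
Proof.
move=> sf [x /(_ 1 ltr01)[P pP Pf]].
pose r n : R := n.+1%:R^-1.
have r0 n : 0 < r n by rewrite invr_gt0.
have /choice[nu nuf] : forall n, exists nu, integral_up_to f (r n) nu.
  move=> n; have r2 := divr_gt0 (r0 n) (ltr0Sn R 1).
  have [|nu] := approximate_indefinite_integral sf pP _ r2.
    by move=> A t pA AP tA; have [] := Pf A t pA AP tA.
  by rewrite mulr2n -splitr; exists nu.
have cvr : r n @[n --> \oo] --> 0 by exact: cvg_harmonic.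
have acnu n := (nuf n).1.
have [e e0|phi acphi cvphi] := absolutely_continuous_complete acnu.
  have /cvgrPdist_le/(_ (e / 2) (divr_gt0 e0 (ltr0Sn _ 1)))[N _ NP] := cvr.
  exists N => n Nn F mF.
  have rle m : (N <= m)%N -> r m <= e / 2.
    by move=> /NP; rewrite /= sub0r normrN ger0_norm// ltW.
  apply: (le_trans (integral_up_to_close sf (nuf N) (nuf n) mF)).
  rewrite -[leRHS]mulr1 ler_pM ?leb_ge0 ?leb_le1//; first by rewrite addr_ge0// ltW.
  by rewrite [leRHS]splitr lerD// rle.
exists phi; split=> // F y d mF Fy.
apply: (@le_cvg_seq _ (fun n => `|nu n F - leb F *: y|)
  (fun n => (d + r n) * leb F)).
- by apply: cvg_norm; apply: cvgB; [exact: cvphi | exact: cvg_cst].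
- by apply: cvgMl; apply: cvgD => //; exact: cvg_cst.
by apply: nearW => n; exact: (nuf n).2.
Qed.

Lemma nneseries_le (a : nat -> R) (e : R) : (forall n, 0 <= a n) ->
  (forall n, \sum_(0 <= i < n) a i <= e) ->
  (\sum_(0 <= n <oo) (a n)%:E <= e%:E)%E.
Proof.
move=> a0 ae; apply: lime_le.
  by apply: is_cvg_nneseries => n _ _; rewrite lee_fin.
by apply: nearW => n; rewrite sumEFin lee_fin.
Qed.

Lemma strongly_Birkhoff_of_Birkhoff f :
  strongly_measurable f -> Birkhoff_integrable f ->
  strongly_Birkhoff_integrable f.
Proof.
move=> sf bf; have [phi [acphi phif]] := indefinite_integral sf bf.
exists phi; split; first exact: absolutely_continuous_sigma_additive.
  move=> A mA A0; apply: absolutely_continuous_null => //.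
  by rewrite /leb A0.
move=> e e0.
have [P pP Pe] := strongly_measurable_almost_constant sf (divr_gt0 e0 (ltr0Sn _ 1)).
exists P => // A t [mA tA _] AP tA'.
have mP n : Lebesgue_sets (P n) by case: pP.
have termwise n : `|leb (A n) *: f (t n) - phi (A n)| <= e * leb (A n).
  have [A0|A0] := eqVneq (leb (A n)) 0.
    rewrite (absolutely_continuous_null acphi (mA n) A0).
    by rewrite A0 scale0r subrr normr0 mulr0.
  have An0 : A n !=set0.
    by apply/set0P; apply: contra_neq A0 => ->; exact: leb0.
  have [m AmP] := AP n; have [P0|[y Py]] := Pe m.
    by case/negP: A0; rewrite eq_le leb_ge0 andbT -P0 le_leb.
  rewrite distrC -[X in X * _]addr0; apply: phif => // s As.
  rewrite -(subrKA y) (le_trans (ler_normD _ _))// [leRHS]splitr.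
  by rewrite lerD ?[`|y - _|]distrC//; apply/Py/AmP => //; exact: tA'.
apply: nneseries_le => // n; apply: (@le_trans _ _ (\sum_(0 <= i < n) e * leb (A i))).
  by apply: ler_sum => i _; exact: termwise.
rewrite -mulr_sumr -[leRHS]mulr1 (ler_wpM2l (ltW e0))//.
have /= := Lebesgue_additive_series n (@leb_setU R) mA tA.
rewrite /series/= => ->; apply: leb_le1; exact: Lebesgue_sets_bigU.
Qed.

End indefinite_integral.

(** * Consequences of strong Birkhoff integrability *)

Section strongly_Birkhoff_integrable_functions.
Context (R : realType) (X : completeNormedModType R).
Implicit Types (f : R -> X) (phi : set R -> X).

(** Absolute convergence, with the bound passed to the norm of the sum. *)
Lemma bounded_normed_series (a : nat -> X) (e : R) :
  (\sum_(0 <= n <oo) `|a n|%:E <= e%:E)%E ->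
  cvgn (series a) /\ `|limn (series a)| <= e.
Proof.
move=> ae.
have ale n : \sum_(0 <= i < n) `|a i| <= e.
  rewrite -lee_fin -sumEFin; apply: le_trans ae.
  by apply: nneseries_lim_ge => i _ _; rewrite lee_fin.
have cva : cvgn (series a).
  apply: normed_cvg; apply: nondecreasing_is_cvgn.
    by apply: nondecreasing_series => i _ _ /=.
  by exists e => _ [n _ <-]; exact: ale.
split=> //; apply: (@le_cvg_seq _ (fun n => `|series a n|) (cst e)).
- exact: cvg_norm.
- exact: cvg_cst.
by apply: nearW => n; rewrite /series/= (le_trans (ler_norm_sum _ _ _)).
Qed.

Lemma countable_partition_comp (A : nat -> set R) (s : nat -> nat) :
  bijective s -> countable_partition A -> countable_partition (A \o s).
Proof.
move=> [s' s's ss'] [mA tA UA]; split=> [n /=|i j _ _ /(tA _ _ Logic.I Logic.I)|].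
- exact: mA.
- exact: (can_inj s's).
rewrite -UA eqEsubset; split=> x [n _ Anx]; first by exists (s n).
by exists (s' n) => //=; rewrite ss'.
Qed.

Lemma Birkhoff_of_strongly_Birkhoff f :
  strongly_Birkhoff_integrable f -> Birkhoff_integrable f.
Proof.
move=> [phi [saphi _ sbf]]; exists (phi unit_interval) => e e0.
have [P pP Pf] := sbf (e / 2) (divr_gt0 e0 (ltr0Sn _ 1)).
exists P => // A t pA AP tA u.
have rearranged s : bijective s ->
    [/\ cvgn (series (u \o s)) &
        `|phi unit_interval - limn (series (u \o s))| <= e / 2].
  move=> bs; have pAs := countable_partition_comp bs pA.
  have := Pf _ (t \o s) pAs (fun n => AP (s n)) (fun n => @tA (s n)).
  move=> /bounded_normed_series[cvd led].
  have [mAs tAs UAs] := pAs.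
  have := saphi _ mAs tAs; rewrite UAs -/unit_interval => cvphi.
  have cvu : series (u \o s) @ \oo -->
      limn (series (fun n => u (s n) - phi (A (s n)))) + phi unit_interval.
    have -> : series (u \o s) = series (fun n => u (s n) - phi (A (s n))) +
        series (phi \o (A \o s)).
      by rewrite -seriesD; congr series; apply/funext => n /=; rewrite subrK.
    exact: cvgD.
  split; first by apply/cvg_ex; eexists; exact: cvu.
  by rewrite (cvg_lim _ cvu)// opprD addrCA subrr addr0 normrN.
split=> [s /rearranged[]//|].
have [|_ le_e] := rearranged id; first by exists id.
by apply: le_lt_trans le_e _; rewrite ltr_pdivrMr// ltr_pMr// ltr1n.
Qed.

(** Call a member of the partition bad when [f] moves by more than [d] away from
    its value at the chosen point.  Moving the points of the bad members to such
    places changes the sum of the [lambda (P n) *: f (t n)], in absolute value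
    term by term, by at least [d] times the measure of the bad members; but for
    both choices the terms are, in total, within [d * (e / 4)] of the values of
    [phi].  Off the bad members and off a tail of the partition, [f] is within [d] of a simple function. *)
Lemma strongly_Birkhoff_simple_approximation f (d e : R) :
  strongly_Birkhoff_integrable f -> 0 < d -> 0 < e ->
  exists s E, [/\ simple_measurable s, Lebesgue_sets E, leb E <= e &
    forall x, unit_interval x -> ~ E x -> `|f x - s x| <= d].
Proof.
move=> [phi [_ _ sbf]] d0 e0.
have [P [mP tP UP] Pf] := sbf (d * (e / 4)) (mulr_gt0 d0 (divr_gt0 e0 (ltr0Sn _ 3))).
have pP : countable_partition P by [].
have [t tP'] := choice_of_points_exists P.
pose bad n := `[< exists2 x, P n x & d < `|f x - f (t n)| >].
(* A second choice of points, far from [t] in the bad members only. *)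
have /choice[b bP] : forall n, exists x, if bad n then P n x /\ d < `|f x - f (t n)|
    else x = t n.
  move=> n; rewrite /bad; case: asboolP => [[x Px dx]|_]; last by exists (t n).
  by exists x.
have bC : choice_of_points P b.
  move=> n Pn; have := bP n; case: (bad n) => [[]//|->].
  exact: tP'.
have PPf := fun t' => Pf P t' pP (fun n => ex_intro _ n (@subset_refl _ (P n))).
pose D t' n := `|leb (P n) *: f (t' n) - phi (P n)|.
have Dle t' n : choice_of_points P t' -> \sum_(0 <= i < n) D t' i <= d * (e / 4).
  move=> tP''; rewrite -lee_fin -sumEFin; apply: le_trans (PPf _ tP'').
  apply: (@nneseries_lim_ge _ (fun i => (D t' i)%:E) xpredT) => i _ _.
  by rewrite lee_fin /D.

pose G n := if bad n then P n else set0.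
have mG n : Lebesgue_sets (G n).
  by rewrite /G; case: (bad n) => //; exact: Lebesgue_sets0.
have GP n : G n `<=` P n by rewrite /G; case: (bad n).
have tG : trivIset setT G.
  by move=> i j _ _ [x [/GP Pi /GP Pj]]; apply: tP => //; exists x.
have mUG : Lebesgue_sets (\bigcup_n G n) by exact: Lebesgue_sets_bigcup.
have lebG : leb (\bigcup_n G n) <= e / 2.
  apply: (@le_cvg_seq _ (series (@leb R \o G)) (cst (e / 2))).
  - exact: leb_bigcup.
  - exact: cvg_cst.
  apply: nearW => n; rewrite /series/= -(ler_pM2l d0) mulr_sumr.
  have -> : d * (e / 2) = d * (e / 4) + d * (e / 4) by rewrite -mulrDr; congr *%R; lra.
  apply: le_trans (lerD (Dle _ n bC) (Dle _ n tP')).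
  rewrite -big_split/=; apply: ler_sum => i _.
  have := bP i; rewrite /G; case: (bad i) => [[_ dlt]|_]; last first.
    by rewrite leb0 mulr0 addr_ge0 // /D.
  rewrite /D [X in _ + X]distrC; apply: le_trans (ler_normD _ _).
  rewrite addrA subrK -scalerBr normrZ ger0_norm ?leb_ge0// mulrC.
  by rewrite ler_wpM2l ?leb_ge0// ltW.
have m01 := @Lebesgue_sets_unit R.
(* Finitely many members carry all but [e / 2] of the measure. *)
have [N Ne] : exists N, leb (unit_interval `\` \big[setU/set0]_(i < N) P i) <= e / 2.
  have := leb_bigcup mP tP; rewrite UP -/unit_interval.
  move=> /cvgrPdist_le/(_ (e / 2) (divr_gt0 e0 (ltr0Sn _ 1)))[N _ NP].
  exists N; have := NP N (leqnn N).
  rewrite /= (Lebesgue_additive_series N (@leb_setU R) mP tP).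
  have mBig := Lebesgue_sets_bigU N mP.
  rewrite (Lebesgue_additiveD (@leb_setU R) m01 mBig); last exact: mBig.2.
  by rewrite addrAC subrr add0r ger0_norm ?leb_ge0.
set T := unit_interval `\` _ in Ne.
have mT : Lebesgue_sets T by apply: Lebesgue_setsD => //; exact: Lebesgue_sets_bigU.
have PE i j x : P i x -> P j x -> i = j.
  by move=> Pi Pj; apply: tP => //; exists x.
pose s x := \sum_(i < N) if x \in P i then f (t i) else 0.
have sE i x : (i < N)%N -> P i x -> s x = f (t i).
  move=> iN Pix; rewrite /s (bigD1 (Ordinal iN))//= mem_set// big1 ?addr0// => j ji.
  rewrite ifF//; apply: memNset => Pjx; move/eqP: ji; apply; apply/val_inj => /=.
  exact: PE Pjx Pix.
have s0 x : T x -> s x = 0.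
  move=> [_ nP]; rewrite /s big1// => i _; rewrite ifF//.
  apply: memNset => Pix; apply: nP.
  by rewrite -bigcup_mkord; exists i => //=.
have TP x : unit_interval x -> T x \/ exists2 i, (i < N)%N & P i x.
  move=> x01; have [|nT] := pselect ((\big[setU/set0]_(i < N) P i) x).
    by rewrite -bigcup_mkord => -[i /= iN Pix]; right; exists i.
  by left.
exists s, ((\bigcup_n G n) `|` T); split.
- split.
    apply: (@sub_finite_set _ _ [set` 0 :: [seq f (t i) | i <- iota 0 N]]) => //.
    move=> _ [x x01 <-] /=; rewrite inE.
    have [Tx|[i iN Pix]] := TP x x01; first by rewrite s0// eqxx.
    by rewrite (sE i)// map_f ?orbT// mem_iota.
  move=> v; have -> : `[0, 1]%classic `&` s @^-1` [set v] =
      \bigcup_(i in [set i | (i < N)%N /\ f (t i) = v]) P i `|`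
      (if v == 0 then T else set0).
    rewrite eqEsubset; split=> [x [x01 /= sx]|x].
      have [Tx|[i iN Pix]] := TP x x01.
        by right; rewrite -sx s0// eqxx.
      by left; exists i => //=; rewrite -(sE i x).
    move=> [[i [iN fi] Pix]|].
      by split; [exact: (mP i).2 | rewrite /= (sE i)].
    by case: eqP => // -> Tx; split; [exact: mT.2 | exact: s0].
  apply: Lebesgue_setsU; first by apply: Lebesgue_sets_bigcup => i _.
  by case: ifP => // _; exact: Lebesgue_sets0.
- exact: Lebesgue_setsU.
- have := @Lebesgue_additiveD _ _ (@leb R) _ _ (@leb_setU R)
    (Lebesgue_setsU mUG mT) mUG (@subsetUl _ _ _).
  move=> ->; rewrite [leRHS]splitr lerD//; apply: le_trans Ne.
  apply: le_leb => //; first by apply: Lebesgue_setsD => //; exact: Lebesgue_setsU.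
  by move=> x [[]].
move=> x x01 nE; have [Tx|[i iN Pix]] := TP x x01; first by case: nE; right.
rewrite (sE i)// leNgt; apply/negP => dlt; apply: nE; left; exists i => //.
by rewrite /G /bad asboolT//; exists x.
Qed.

(** With errors [2 ^- k], the exceptional sets have summable measures, so almost
    every point lies in finitely many of them. *)
Lemma strongly_measurable_of_strongly_Birkhoff f :
  strongly_Birkhoff_integrable f -> strongly_measurable f.
Proof.
move=> sbf; pose r k : R := 2^-1 ^+ k.
have r0 k : 0 < r k by rewrite exprn_gt0// invr_gt0.
have cvr : r k @[k --> \oo] --> 0.
  by apply: cvg_expr; rewrite ger0_norm ?invf_lt1 ?invr_ge0// ltr1n.
have /choice[sE sEP] : forall k, exists sE : (R -> X) * set R,
    [/\ simple_measurable sE.1, Lebesgue_sets sE.2, leb sE.2 <= r k &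
    forall x, unit_interval x -> ~ sE.2 x -> `|f x - sE.1 x| <= r k].
  move=> k; have [s [E ?]] := strongly_Birkhoff_simple_approximation sbf (r0 k) (r0 k).
  by exists (s, E).
pose E k := (sE k).2.
have mE k : Lebesgue_sets (E k) by case: (sEP k).
exists (fun k => (sE k).1); split; first by move=> k; case: (sEP k).
exists (lim_sup_set E); split.
- apply: (@bigcapT_measurable _ (caratheodory_type (wlength idfun)^*%mu)) => n.
  apply: (@bigcup_measurable _ (caratheodory_type (wlength idfun)^*%mu)) => k _.
  exact: (mE k).1.
- apply: lim_sup_set_cvg0 => [k|]; first exact: (mE k).1.
  apply: (@le_lt_trans _ _ 2%:E); last exact: ltry.
  rewrite (eq_eseriesr (g := fun k => (leb (E k))%:E)); last first.
    by move=> k _; rewrite -lambdaE.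
  apply: nneseries_le => [k|n]; first exact: leb_ge0.
  apply: (@le_trans _ _ (\sum_(0 <= k < n) r k)).
    by apply: ler_sum => k _; case: (sEP k).
  suff -> : \sum_(0 <= k < n) r k = 2 - 2 * r n.
    by rewrite lerBlDr lerDl mulr_ge0// ltW.
  elim: n => [|n IHn]; first by rewrite big_geq// /r expr0 mulr1 subrr.
  by rewrite big_nat_recr//= IHn /r exprS; field.
move=> x /= nsf k _; apply: contrapT => nE; apply: nsf => x01.
apply/cvgrPdist_le => e e0.
have /cvgrPdist_le/(_ e e0)[N _ NP] := cvr.
exists (maxn k N) => // m /=; rewrite geq_max => /andP[km Nm].
have [_ _ _ /(_ x x01)] := sEP m.
have nEm : ~ E m x by move=> Em; apply: nE; exists m.
move=> /(_ nEm) /le_trans; apply; have := NP m Nm.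
by rewrite /= sub0r normrN ger0_norm// ltW.
Qed.

End strongly_Birkhoff_integrable_functions.

Theorem theorem3p13 (R : realType) (X : completeNormedModType R) (f : R -> X) :
  strongly_Birkhoff_integrable f <->
  strongly_measurable f /\ Birkhoff_integrable f.
Proof.
split=> [sbf|[sf bf]]; last exact: strongly_Birkhoff_of_Birkhoff.
split; first exact: strongly_measurable_of_strongly_Birkhoff.
exact: Birkhoff_of_strongly_Birkhoff.
Qed.
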